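(* Let $f:[0,\infty)\to\mathbb{R}$ be a function with $f(0)=0$ and let $\psi:\mathbb{R}\times\mathbb{R}\to\mathbb{R}$ be given by $\psi(x,t):=\operatorname{sign}(x-t)f(|x-t|)$, $x,t\in\mathbb{R}$. Then we have that (a) $\psi\in\Psi[T_1](\mathbb{R},\mathbb{R})$ if and only if $f(z)>0$ for all $z>0$, and, in this case, $\vartheta_1(x)=x$ and $\psi(x,\vartheta_1(x))=0$ hold for all $x\in\mathbb{R}$; (b) if $\psi\in\Psi[T_n](\mathbb{R},\mathbb{R})$ for infinitely many $n\in\mathbb{N}$, then $f$ is increasing; (c) $\psi\in\Psi[T_2^{\boldsymbol{\lambda}}](\mathbb{R},\mathbb{R})$ for each $\boldsymbol{\lambda}\in\Lambda_2$ if and only if $f$ is strictly increasing; (d) $\psi\in\Psi[T_n^{\boldsymbol{\lambda}}](\mathbb{R},\mathbb{R})$ for each $n\in\mathbb{N}$ and $\boldsymbol{\lambda}\in\Lambda_n$ if and only if $f$ is strictly increasing.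
   Context: $\mathbb{N}$ is the set of positive integers; $\Lambda_n:=[0,\infty)^n\setminus\{(0,\ldots,0)\}$; $\operatorname{sign}(0)=0$. ''Increasing'' means nondecreasing in the weak sense. Point of sign change: for $g:\mathbb{R}\to\mathbb{R}$, an element $\vartheta\in\mathbb{R}$ is a point of sign change (of decreasing type) for $g$ if $g(t)>0$ for all $t<\vartheta$ and $g(t)<0$ for all $t>\vartheta$. $\Psi(\mathbb{R},\mathbb{R})$ is the class of functions $\psi:\mathbb{R}\times\mathbb{R}\to\mathbb{R}$ such that for each $x\in\mathbb{R}$ there exist $t_+<t_-$ in $\mathbb{R}$ with $\psi(x,t_+)>0>\psi(x,t_-)$. For $\boldsymbol{\lambda}\in\Lambda_n$, $\psi\in\Psi[T_n^{\boldsymbol{\lambda}}](\mathbb{R},\mathbb{R})$ means that $\psi\in\Psi(\mathbb{R},\mathbb{R})$ and for every $(x_1,\ldots,x_n)\in\mathbb{R}^n$ the function $\mathbb{R}\ni t\mapsto\sum_{i=1}^n\lambda_i\psi(x_i,t)$ has a (necessarily unique) point of sign change. $\Psi[T_n](\mathbb{R},\mathbb{R})$ is the case $\boldsymbol{\lambda}=(1,\ldots,1)$, and then the point of sign change is denoted $\vartheta_n(x_1,\ldots,x_n)$. *)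

(* Defs.v *)
From mathcomp Require Import all_boot all_order all_algebra.
From mathcomp Require Import all_classical all_reals.

Set Implicit Arguments.
Unset Strict Implicit.
Unset Printing Implicit Defensive.

Import Order.TTheory GRing.Theory Num.Theory.
Local Open Scope classical_set_scope.
Local Open Scope ring_scope.

Definition sign_change_point (R : realType) (g : R -> R) (theta : R) : Prop :=
  (forall t, t < theta -> 0 < g t) /\ (forall t, theta < t -> g t < 0).

Lemma sign_change_point_unique (R : realType) (g : R -> R) (a b : R) :
  sign_change_point g a -> sign_change_point g b -> a = b.
Proof.
suff main c d : sign_change_point g c -> sign_change_point g d -> ~ c < d.
  move=> ga gb; case: (ltgtP a b) => // ab; first by case: (main a b).
  by case: (main b a).
move=> [_ gc] [gd _] cd; have [c_lt lt_d] := midf_lt cd.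
by have := lt_trans (gd _ lt_d) (gc _ c_lt); rewrite ltxx.
Qed.

(* Lambda_n = [0, oo)^n \ {(0, ..., 0)}; in particular it is empty for n = 0. *)
Definition Lambda (R : realType) (n : nat) : set ('I_n -> R) :=
  [set lam | (forall i, 0 <= lam i) /\ lam <> (fun=> 0)].
Arguments Lambda : clear implicits.

Definition Psi (R : realType) : set (R -> R -> R) :=
  [set psi | forall x, exists tp tm : R,
    [/\ tp < tm, 0 < psi x tp & psi x tm < 0]].
Arguments Psi : clear implicits.

Definition weighted_sum (R : realType) (n : nat) (lam : 'I_n -> R)
    (psi : R -> R -> R) (x : 'I_n -> R) (t : R) : R :=
  \sum_(i < n) lam i * psi (x i) t.

(* Psi[T_n^lam](R, R) *)
Definition PsiTw (R : realType) (n : nat) (lam : 'I_n -> R)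
    : set (R -> R -> R) :=
  [set psi | Psi R psi /\
    forall x : 'I_n -> R,
      exists theta, sign_change_point (weighted_sum lam psi x) theta].

(* Psi[T_n](R, R) *)
Definition PsiT (R : realType) (n : nat) : set (R -> R -> R) :=
  PsiTw (fun _ : 'I_n => 1).
Arguments PsiT : clear implicits.

(* vartheta_n(x_1, ..., x_n): the point of sign change for unit weights, with
   the junk value 0 when there is none. *)
Definition vartheta (R : realType) (n : nat) (psi : R -> R -> R)
    (x : 'I_n -> R) : R :=
  xget 0 [set theta |
    sign_change_point (weighted_sum (fun _ : 'I_n => 1) psi x) theta].

(* Only the values of f on [0, oo) matter. *)
Definition psi_of (R : realType) (f : R -> R) (x t : R) : R :=
  Num.sg (x - t) * f `|x - t|.

(* Main.v *)
Require Import Defs.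
From mathcomp Require Import all_boot all_order all_algebra.
From mathcomp Require Import all_classical all_reals.
From mathcomp Require Import lra zify.

Set Implicit Arguments.
Unset Strict Implicit.
Unset Printing Implicit Defensive.

Import Order.TTheory GRing.Theory Num.Theory.
Local Open Scope classical_set_scope.
Local Open Scope ring_scope.

(** The function [psi] is the kernel [psi x t = F (x - t)], where [F] is the
odd extension of [f] to the whole line.

Sufficiency.  If [f] is strictly increasing then so is [F]; hence every
weighted sum of the [F (x i - t)] is strictly decreasing in [t], positive to
the left of all the [x i] and negative to the right of them.  The supremum of
the set where it is positive is then a point of sign change
([decreasing_sign_change]).

Necessity.  For [0 <= x < y] put [k] points at [0] and the remaining [n - k]
at [x + y].  The sum takes the values [(n - k) f y - k f x] at [x] and
[(n - k) f x - k f y] at [y], that is, the numbers [f x] and [f y] trade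
places.  A point of sign change forbids the first value to be nonpositive
while the second is nonnegative ([two_cluster_crossing]).  With [n = 2] and
[k = 1] this gives [f x < f y].  For large [n] and [k] about [n / 2] the ratio
of the two cluster sizes is as close to 1 as desired, so that [f y < f x]
is excluded as soon as arbitrarily large [n] are available.

For a single point [x], the sum vanishes at [t = x], so that [x] is the only
possible point of sign change. *)

Lemma sign_change_point_lt0 (R : realType) (g : R -> R) (theta s t : R) :
  sign_change_point g theta -> g s <= 0 -> s < t -> g t < 0.
Proof.
move=> [gpos gneg] gs st; apply: gneg; apply: le_lt_trans st.
by rewrite leNgt; apply/negP => /gpos; rewrite ltNge gs.
Qed.

Lemma sign_change_point_zero (R : realType) (g : R -> R) (theta t : R) :
  sign_change_point g theta -> g t = 0 -> theta = t.
Proof.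
move=> [gpos gneg] gt0.
by case: (ltgtP theta t) => // [/gneg|/gpos]; rewrite gt0 ltxx.
Qed.

(** The point is the supremum of the set where [g] is positive.  To the right
of it [g] is a priori only nonpositive; strict monotonicity, used between the
supremum and [t], makes it negative. *)
Lemma decreasing_sign_change (R : realType) (g : R -> R) (a b : R) :
  {homo g : s t /~ s < t} -> 0 < g a -> g b < 0 ->
  exists theta, sign_change_point g theta.
Proof.
move=> gdec ga gb; pose S := [set t | 0 < g t].
have ubS : ubound S b.
  move=> t /= gt; rewrite leNgt; apply/negP => /gdec.
  by move=> /(lt_trans gt) /lt_trans/(_ gb); rewrite ltxx.
have supS : has_sup S by split; [exists a | exists b].
exists (sup S); split=> t lt_t.
  have [s Ss ts] := sup_adherent (ltac:(by rewrite subr_gt0) : 0 < sup S - t) supS.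
  by apply: lt_trans (gdec _ _ _); [exact: Ss | rewrite subKr in ts].
have [sm mt] := midf_lt lt_t.
apply: lt_le_trans (gdec _ _ mt) _; rewrite leNgt; apply/negP => gm.
by have := ub_le_sup (ex_intro _ b ubS) gm; rewrite leNgt sm.
Qed.

Section OddKernel.
Variables (R : realType) (f : R -> R).

Definition odd_ext (s : R) : R := Num.sg s * f `|s|.

Lemma psi_ofE (x t : R) : psi_of f x t = odd_ext (x - t).
Proof. by []. Qed.

Lemma odd_extN (s : R) : odd_ext (- s) = - odd_ext s.
Proof. by rewrite /odd_ext sgrN normrN mulNr. Qed.

Lemma odd_ext0 : odd_ext 0 = 0.
Proof. by rewrite /odd_ext sgr0 mul0r. Qed.

Lemma odd_ext_gt0 (s : R) : 0 < s -> odd_ext s = f s.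
Proof. by move=> s0; rewrite /odd_ext gtr0_sg // mul1r gtr0_norm. Qed.

Lemma odd_ext_ge0 (s : R) : f 0 = 0 -> 0 <= s -> odd_ext s = f s.
Proof.
by move=> f0; rewrite le_eqVlt => /predU1P[<-|/odd_ext_gt0//]; rewrite odd_ext0.
Qed.

Lemma odd_ext_increasing :
  f 0 = 0 -> {in `[0, +oo[ &, {homo f : x y / x < y}} ->
  {homo odd_ext : s t / s < t}.
Proof.
move=> f0 finc.
have inc s t : 0 <= s -> s < t -> odd_ext s < odd_ext t.
  move=> s0 st; have t0 := le_trans s0 (ltW st).
  by rewrite !odd_ext_ge0 // finc // in_itv /= andbT.
have incN s t : t <= 0 -> s < t -> odd_ext s < odd_ext t.
  move=> t0 st; rewrite -(opprK s) -(opprK t) !(odd_extN (- _)) ltrN2.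
  by apply: inc; rewrite ?oppr_ge0 ?ltrN2.
move=> s t st; have [s0|s0] := leP 0 s; first exact: inc.
have [t0|t0] := leP t 0; first exact: incN.
by apply: lt_trans (incN s 0 _ s0) (inc 0 t _ t0).
Qed.

Lemma psi_of_Psi : (forall z, 0 < z -> 0 < f z) -> Psi R (psi_of f).
Proof.
move=> fpos x; exists (x - 1), (x + 1).
have F1 : 0 < odd_ext 1 by rewrite odd_ext_gt0 // fpos.
rewrite !psi_ofE subKr opprD addNKr odd_extN oppr_lt0; split=> //; lra.
Qed.

Lemma weighted_sum1E (x : 'I_1 -> R) (t : R) :
  weighted_sum (fun=> 1) (psi_of f) x t = odd_ext (x ord0 - t).
Proof. by rewrite /weighted_sum big_ord1 mul1r. Qed.

(** The kernel vanishes on the diagonal, which pins the point down. *)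
Lemma sign_change_point1 (x : 'I_1 -> R) (theta : R) :
  sign_change_point (weighted_sum (fun=> 1) (psi_of f) x) theta ->
  theta = x ord0.
Proof.
by move/sign_change_point_zero; apply; rewrite weighted_sum1E subrr odd_ext0.
Qed.

Lemma PsiT1P : PsiT R 1 (psi_of f) <-> (forall z, 0 < z -> 0 < f z).
Proof.
split=> [[_ /(_ (fun=> 0))[theta sc]] z z0 | fpos].
  have /= th := sign_change_point1 sc; case: sc => /(_ (- z)) + _.
  by rewrite th oppr_lt0 weighted_sum1E sub0r opprK odd_ext_gt0 //; apply.
split=> [|x]; first exact: psi_of_Psi.
exists (x ord0); split=> t tx; rewrite weighted_sum1E.
  by rewrite odd_ext_gt0 ?fpos ?subr_gt0.
by rewrite -opprB odd_extN odd_ext_gt0 ?oppr_lt0 ?fpos ?subr_gt0.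
Qed.

Lemma vartheta1E (x : R) :
  PsiT R 1 (psi_of f) -> vartheta (psi_of f) (fun _ : 'I_1 => x) = x.
Proof.
move=> [_ /(_ (fun=> x))[theta sc]]; rewrite /vartheta.
by case: xgetP => [y _ /sign_change_point1 //|/(_ theta)].
Qed.

Lemma weighted_sum_clusters (n k : nat) (a b t : R) : (k <= n)%N ->
  weighted_sum (fun=> 1) (psi_of f) (fun i : 'I_n => if (i < k)%N then a else b) t
  = k%:R * odd_ext (a - t) + (n - k)%:R * odd_ext (b - t).
Proof.
move=> kn; rewrite /weighted_sum.
pose G i := odd_ext ((if (i < k)%N then a else b) - t).
under eq_bigr do rewrite mul1r psi_ofE -/(G _).
rewrite -(big_mkord xpredT G) (big_cat_nat (n := k)) //=.
rewrite (@eq_big_nat _ _ _ 0 k _ (fun=> odd_ext (a - t))); last first.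
  by move=> i /andP[_ ik]; rewrite /G ik.
rewrite (@eq_big_nat _ _ _ k n _ (fun=> odd_ext (b - t))); last first.
  by move=> i /andP[ki _]; rewrite /G ltnNge ki.
by rewrite !sumr_const_nat subn0 !mulr_natl.
Qed.

(** Evaluating two clusters, at distance [x + y] from each other, at the points
[x] and [y] exchanges the roles of [f x] and [f y]. *)
Lemma two_cluster_crossing (n k : nat) (x y : R) :
  f 0 = 0 -> PsiT R n (psi_of f) -> (k <= n)%N -> 0 <= x -> x < y ->
  (n - k)%:R * f y <= k%:R * f x -> (n - k)%:R * f x < k%:R * f y.
Proof.
move=> f0 [_ sc] kn x0 xy; have y0 := le_trans x0 (ltW xy).
have [theta {}sc] := sc (fun i : 'I_n => if (i < k)%N then 0 else x + y).
have := @sign_change_point_lt0 _ _ _ x y sc.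
rewrite !weighted_sum_clusters // !sub0r !odd_extN addrK (addrC x y) addrK.
rewrite !odd_ext_ge0 // !mulrN ![- _ + _]addrC subr_le0 subr_lt0.
by move=> h /h; apply.
Qed.

(** Two clusters of one point each: [f y <= f x] would imply [f x < f y]. *)
Lemma PsiT2_increasing :
  f 0 = 0 -> PsiT R 2 (psi_of f) -> {in `[0, +oo[ &, {homo f : x y / x < y}}.
Proof.
move=> f0 P2 x y; rewrite !in_itv /= !andbT => x0 _ xy.
rewrite ltNge; apply/negP => fyx.
have := @two_cluster_crossing 2 1 x y f0 P2 isT x0 xy.
by rewrite !mul1r => /(_ fyx); rewrite ltNge fyx.
Qed.

(** For [n] points and [k = n / 2] rounded down, the last hypothesis and the
conclusion of [two_cluster_crossing] compare about [n / 2] copies of [f x] with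
as many of [f y].  If [f y < f x], the hypothesis holds and the conclusion
fails once [n] is large. *)
Lemma PsiT_infinite_increasing :
  f 0 = 0 -> infinite_set [set n : nat | (0 < n)%N /\ PsiT R n (psi_of f)] ->
  {in `[0, +oo[ &, {homo f : x y / x <= y}}.
Proof.
move=> f0 inf x y; rewrite !in_itv /= !andbT => x0 _.
rewrite le_eqVlt => /predU1P[->//|xy]; rewrite leNgt; apply/negP => fyx.
have d0 : 0 < f x - f y by rewrite subr_gt0.
(* [k0] makes the gain [k * (f x - f y)] outweigh one stray copy of [f x] or
   [f y], which appears when the cluster sizes differ by one. *)
pose c := `|f x| + `|f y|; pose k0 := Num.truncn (c / (f x - f y)).
have ck0 : c < k0.+1%:R * (f x - f y).
  by rewrite -ltr_pdivrMr //; exact: truncnS_gt.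
have [n [_ Pn] nk0] : exists2 n : nat,
    (0 < n)%N /\ PsiT R n (psi_of f) & (k0.+1.*2 <= n)%N.
  apply: contrapT => small; apply: inf.
  apply: (sub_finite_set _ (finite_II k0.+1.*2)) => n /= Sn.
  by rewrite ltnNge; apply/negP => ?; apply: small; exists n.
have kn : (n./2 <= n)%N by lia.
have [b nE] : exists b : bool, (n - n./2 = n./2 + b)%N.
  by exists (odd n); rewrite -{1}(odd_double_half n); lia.
have gain : c < n./2%:R * (f x - f y).
  apply: lt_le_trans ck0 _; rewrite ler_pM2r // ler_nat.
  by rewrite -(doubleK k0.+1) half_leq.
have := @two_cluster_crossing n n./2 x y f0 Pn kn x0 xy.
rewrite nE natrD !mulrDl => h.
have lec (z : R) : - `|z| <= b%:R * z <= `|z|.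
  by rewrite -ler_norml; case: (b); rewrite ?mul1r ?mul0r ?normr0.
move: gain (lec (f x)) (lec (f y)); rewrite mulrBr /c => gain.
move=> /andP[x1 x2] /andP[y1 y2].
have nx := normr_ge0 (f x); have ny := normr_ge0 (f y).
suff /h : n./2%:R * f y + b%:R * f y <= n./2%:R * f x by lra.
by lra.
Qed.

(** Weights may vanish, but one of them is positive and makes the inequality
strict. *)
Lemma weighted_sum_decreasing (n : nat) (lam : 'I_n -> R) (x : 'I_n -> R) :
  Lambda R n lam -> {homo odd_ext : s t / s < t} ->
  {homo weighted_sum lam (psi_of f) x : s t /~ s < t}.
Proof.
move=> [lam0 lamN0] Finc t s st.
have [i li] : exists i, 0 < lam i.
  apply: contrapT => none; apply: lamN0; apply/funext => i; apply/eqP.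
  by rewrite eq_le lam0 andbT leNgt; apply/negP => ?; apply: none; exists i.
have Flt j : odd_ext (x j - t) < odd_ext (x j - s).
  by apply: Finc; rewrite ltrD2l ltrN2.
rewrite /weighted_sum (bigD1 i) //= [ltRHS](bigD1 i) //=.
apply: ltr_leD; first by rewrite ltr_pM2l // !psi_ofE.
by apply: ler_sum => j _; rewrite ler_wpM2l // !psi_ofE ltW.
Qed.

Lemma increasing_PsiTw (n : nat) (lam : 'I_n -> R) :
  f 0 = 0 -> {in `[0, +oo[ &, {homo f : x y / x < y}} ->
  Lambda R n lam -> PsiTw lam (psi_of f).
Proof.
move=> f0 finc Llam; have Finc := odd_ext_increasing f0 finc.
split=> [|x].
  apply: psi_of_Psi => z z0; rewrite -f0 finc // in_itv /= andbT //.
  exact: ltW.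
have gdec := weighted_sum_decreasing x Llam Finc; have [lam0 _] := Llam.
pose M := \sum_i `|x i|.
have xM i : - M <= x i <= M.
  by rewrite -ler_norml /M (bigD1 i) //= lerDl sumr_ge0.
(* Left of all the [x i] no term is negative and right of them none is
   positive; one further step makes the inequalities for the sum strict. *)
have Fle := ltW_homo Finc.
have left_ge0 : 0 <= weighted_sum lam (psi_of f) x (- M).
  apply: sumr_ge0 => i _; rewrite mulr_ge0 // psi_ofE -odd_ext0.
  by apply: Fle; have := xM i; lra.
have right_le0 : weighted_sum lam (psi_of f) x M <= 0.
  apply: sumr_le0 => i _; rewrite mulr_ge0_le0 // psi_ofE -odd_ext0.
  by apply: Fle; have := xM i; lra.
apply: (decreasing_sign_change (a := - M - 1) (b := M + 1) gdec).
  by apply: le_lt_trans left_ge0 (gdec _ _ _); lra.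
by apply: lt_le_trans (gdec _ _ _) right_le0; lra.
Qed.

End OddKernel.

Lemma Lambda_const1 (R : realType) (n : nat) : Lambda R n.+1 (fun=> 1).
Proof.
split=> [i|/(congr1 (@^~ ord0))/eqP]; first exact: ler01.
by rewrite oner_eq0.
Qed.

Theorem proposition4p7 (R : realType) (f : R -> R) (f0 : f 0 = 0) :
  [/\ (PsiT R 1 (psi_of f) <-> (forall z : R, 0 < z -> 0 < f z)) /\
      (PsiT R 1 (psi_of f) ->
        forall x : R, vartheta (psi_of f) (fun _ : 'I_1 => x) = x /\
          psi_of f x (vartheta (psi_of f) (fun _ : 'I_1 => x)) = 0),
      infinite_set [set n : nat | (0 < n)%N /\ PsiT R n (psi_of f)] ->
        {in `[0, +oo[ &, {homo f : x y / x <= y}},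
      (forall lam : 'I_2 -> R, Lambda R 2 lam -> PsiTw lam (psi_of f)) <->
        {in `[0, +oo[ &, {homo f : x y / x < y}}
    & (forall (n : nat) (lam : 'I_n -> R), (0 < n)%N -> Lambda R n lam ->
        PsiTw lam (psi_of f)) <->
        {in `[0, +oo[ &, {homo f : x y / x < y}}].
Proof.
split.
- split=> [|P1 x]; first exact: PsiT1P.
  by rewrite vartheta1E // psi_ofE subrr odd_ext0.
- exact: PsiT_infinite_increasing.
- split=> [P|finc lam]; last exact: increasing_PsiTw.
  exact: PsiT2_increasing f0 (P _ (Lambda_const1 R 1)).
- split=> [P|finc n lam _]; last exact: increasing_PsiTw.
  exact: PsiT2_increasing f0 (P 2 _ isT (Lambda_const1 R 1)).
Qed.
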